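(* Let $F$ be a field, let $m(x)=x^3+ax^2+bx+c\in F[x]$ be irreducible, and let $S\subseteq\mathcal{C}(m)$. (1) Assume that $m$ is separable. If $S$ contains matrices $A$, $B$, and $C$ such that $B-A$ is invertible, $C-A$ is invertible, and $(B-A)B(B-A)^{-1}\neq (C-A)C(C-A)^{-1}$, then $S$ is core. (2) If $F=\mathbb{F}_q$, $|S|\geq q^3-q^2-q+1$, and there exists $A\in S$ such that $S\subseteq\mathcal{D}_A\cup\{A\}$, then $S$ is core.
   Context: $M_3(F)$ is the ring of $3\times 3$ matrices over $F$. $\mathcal{C}(m)$ is the set of all $A\in M_3(F)$ whose minimal polynomial is $m$. For $A\in\mathcal{C}(m)$, $\mathcal{D}_A=\{B\in\mathcal{C}(m) : B-A \text{ is invertible}\}$. For polynomials in $M_3(F)[x]$ the indeterminate $x$ is central, and $f(x)=\sum_i \alpha_i x^i$ is evaluated at $A\in M_3(F)$ by right evaluation, $f(A)=\sum_i \alpha_i A^i$. For $S\subseteq M_3(F)$, the null ideal is $N(S)=\{f\in M_3(F)[x] : f(A)=0 \text{ for all } A\in S\}$. The set $S$ is called core if $N(S)$ is a two-sided ideal of $M_3(F)[x]$. *)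

(* Defs.v *)
From HB Require Import structures.
From mathcomp Require Import all_boot all_order all_algebra all_field.
From mathcomp Require Import classical_sets functions cardinality.

Set Implicit Arguments.
Unset Strict Implicit.
Unset Printing Implicit Defensive.

Import GRing.Theory.
Local Open Scope classical_set_scope.
Local Open Scope ring_scope.

Definition minpoly_class (F : fieldType) (m : {poly F}) : set 'M[F]_3 :=
  [set A | mxminpoly A = m].

Definition unit_diff (F : fieldType) (m : {poly F}) (A : 'M[F]_3) :
    set 'M[F]_3 :=
  [set B | minpoly_class m B /\ B - A \is a GRing.unit].

(* Not required to be proper: the null ideal of the empty set is the ring. *)
Definition two_sided_ideal (R : nzRingType) (I : set R) : Prop :=
  [/\ I 0,
      forall x y, I x -> I y -> I (x - y),
      forall r x, I x -> I (r * x)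
    & forall r x, I x -> I (x * r)].

(* In [{poly R}] the indeterminate is central even if [R] is not commutative,
   and [f.[A]] is right evaluation, \sum_i f`_i * A ^+ i ([horner_coef]). *)
Definition null_ideal (F : fieldType) (S : set 'M[F]_3) :
    set {poly 'M[F]_3} :=
  [set f | forall A, S A -> f.[A] = 0].

Definition is_core (F : fieldType) (S : set 'M[F]_3) : Prop :=
  two_sided_ideal (null_ideal S).

(* Main.v *)
(* If the remainder [r2 x^2 + r1 x + r0] of [f] modulo [m] vanishes at [A] and at
   [B] with [B - A] invertible, then [r2 P + r2 A + r1 = 0] for
   [P = (B - A) B (B - A)^-1].  Two distinct such conjugates [P] and [P'] give
   [r2 (P - P') = 0].  Both are roots of the quotient of [m] by [x - A], so
   [Q (P - P') = (P - P') P'] with [Q = - (a + A + P)]; as [P'] is a root of the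
   irreducible [m], Schur's lemma makes [P - P'] invertible, whence [r2 = 0] and
   [r1 = r0 = 0].  So the null ideal is generated by the central polynomial [m].

   For (2), all [B] with the same conjugate [P] give invertible solutions
   [Y = (B - A)^-1] of [Y P - A Y = 1].  There are at most [q^3] solutions.  If
   there are at least two, every nonzero row vector is killed by some solution,
   while each solution has rank at least 2 and so kills at most [q - 1] of them:
   at least [q^2 + q + 1] solutions are singular. *)
Require Import Defs.
From HB Require Import structures.
From mathcomp Require Import all_boot all_order all_algebra all_field.
From mathcomp Require Import mxabelem zify.
From mathcomp Require Import classical_sets functions cardinality.

Set Implicit Arguments.
Unset Strict Implicit.
Unset Printing Implicit Defensive.

Import GRing.Theory.
Local Open Scope ring_scope.

(** * Cyclic vectors and intertwiners for roots of an irreducible polynomial *)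

Lemma horner_mx_irr_unit (F : fieldType) (n : nat) (m p : {poly F})
    (A : 'M[F]_n.+1) :
  irreducible_poly m -> horner_mx A m = 0 -> ~~ (m %| p) ->
  horner_mx A p \is a GRing.unit.
Proof.
move=> m_irr mA0 m_ndvd_p.
have /Bezout_coprimepP[[u v] /= uv1] : coprimep m p.
  by rewrite irreducible_poly_coprime.
(* Bezout holds only up to nonzero scalars, hence [k] and [l]. Evaluated at the root [A] of [m], it
   makes a multiple of [v(A)] inverse to [p(A)]. *)
have /eqpP[[k l] /= /andP[k0 l0] e] := uv1.
have : horner_mx A (k *: (u * m + v * p)) = l%:M.
  by rewrite e -mul_polyC mulr1 horner_mx_C.
rewrite linearZ rmorphD /= !rmorphM /= mA0 mulr0 add0r scalerAl => e1.
apply: (@mulmx1_unit _ _ (l^-1 *: (k *: horner_mx A v)) _ _).2.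
by rewrite -scalemxAl [X in _ *: X]e1 scale_scalar_mx mulVf.
Qed.

(** The Krylov matrix of [w]: it is invertible exactly when [w] is a cyclic vector for [A]. *)
Definition cyclic_mx (F : fieldType) (n : nat) (w : 'rV[F]_n.+1)
    (A : 'M[F]_n.+1) : 'M[F]_n.+1 :=
  \matrix_(k < n.+1) (w *m A ^+ k).

Lemma mul_cyclic_mx (F : fieldType) (n : nat) (w x : 'rV[F]_n.+1)
    (A : 'M[F]_n.+1) :
  x *m cyclic_mx w A = w *m horner_mx A (rVpoly x).
Proof.
rewrite mulmx_sum_row /rVpoly poly_def rmorph_sum mulmx_sumr.
apply: eq_bigr => i _.
rewrite rowK valK /= horner_mxZ -scalemxAr rmorphXn /=.
by rewrite horner_mx_X.
Qed.

(** A nonzero [x] in the left kernel is a nonzero polynomial of degree less than that of [m], so its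
    value at [A] is invertible and cannot kill [w]. *)
Lemma cyclic_mx_unit (F : fieldType) (n : nat) (m : {poly F})
    (w : 'rV[F]_n.+1) (A : 'M[F]_n.+1) :
  irreducible_poly m -> size m = n.+2 -> horner_mx A m = 0 -> w != 0 ->
  cyclic_mx w A \in unitmx.
Proof.
move=> m_irr m_size mA0 w0.
rewrite unitmxE unitfE; apply/det0P => -[x x0 /eqP].
rewrite mul_cyclic_mx => /eqP wx0.
have xU : horner_mx A (rVpoly x) \in unitmx.
  apply: (horner_mx_irr_unit m_irr mA0).
  have px0 : rVpoly x != 0.
    apply: contra_neq x0 => x0; apply: (can_inj rVpolyK).
    by rewrite x0 linear0.
  apply/negP => /(dvdp_leq px0).
  by rewrite m_size leqNgt ltnS size_poly.
by case/eqP: w0; rewrite -[w](mulmxK xU) wx0 mul0mx.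
Qed.

(* A nonzero row [w] of [Z] generates the whole space under [P], and all its
   iterates stay in the row space of [Z]. *)
Lemma intertwiner_unit (F : fieldType) (n : nat) (m : {poly F})
    (A P Z : 'M[F]_n.+1) :
  irreducible_poly m -> size m = n.+2 -> horner_mx P m = 0 ->
  A * Z = Z * P -> Z != 0 -> Z \is a GRing.unit.
Proof.
move=> m_irr m_size mP0 AZ Z0.
have [i zi0] : exists i, row i Z != 0.
  apply/existsP; apply: contraR Z0 => /existsPn Z0.
  by apply/eqP/row_matrixP => i; rewrite row0; apply/eqP; rewrite -[_ == _]negbK.
have AkZ k : A ^+ k * Z = Z * P ^+ k.
  elim: k => [|k IH]; first by rewrite !expr0 mul1r mulr1.
  by rewrite exprS -mulrA IH mulrA AZ -mulrA -exprS.
have := cyclic_mx_unit m_irr m_size mP0 zi0.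
suff -> : cyclic_mx (row i Z) P = cyclic_mx (delta_mx 0 i) A *m Z.
  by rewrite unitmx_mul => /andP[].
apply/row_matrixP => k; rewrite row_mul !rowK rowE -!mulmxA.
by congr (_ *m _); symmetry; exact: AkZ.
Qed.

(** * Roots of the cubic obtained by conjugation *)

Lemma horner_mx_cubic (F : fieldType) (n : nat) (a b c : F)
    (A : 'M[F]_n.+1) :
  horner_mx A ('X^3 + a *: 'X^2 + b *: 'X + c%:P) =
  A ^+ 3 + a *: A ^+ 2 + b *: A + c%:M.
Proof.
by rewrite !rmorphD /= !horner_mxZ !rmorphXn /= !horner_mx_X horner_mx_C.
Qed.

Lemma horner_mx_conj (F : fieldType) (n : nat) (p : {poly F})
    (B D : 'M[F]_n.+1) :
  D \is a GRing.unit -> horner_mx B p = 0 -> horner_mx (D * B / D) p = 0.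
Proof.
move=> DU; suff -> : horner_mx (D * B / D) p = D * horner_mx B p / D.
  by move=> ->; rewrite mulr0 mul0r.
elim/poly_ind: p => [|p k IH]; first by rewrite !raddf0 mulr0 mul0r.
rewrite !rmorphD !rmorphM /= IH !horner_mx_X !horner_mx_C mulrDr mulrDl.
congr (_ + _); first by rewrite !mulrA mulrVK.
by rewrite -[D * _]/(D *m _) scalar_mxC; exact/esym/(mulrK DU).
Qed.

(* [m = (x - Q) (x - P) (x - A)] in ['M_n[x]]; comparing coefficients of [x]
   eliminates [Q]. *)
Lemma conj_root_quadratic (F : fieldType) (n : nat) (a b c : F)
    (A B : 'M[F]_n.+1) :
  let m := 'X^3 + a *: 'X^2 + b *: 'X + c%:P in
  let P := (B - A) * B / (B - A) in
  horner_mx A m = 0 -> horner_mx B m = 0 -> B - A \is a GRing.unit ->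
  P ^+ 2 + A * P + A ^+ 2 + a *: (P + A) + b%:M = 0.
Proof.
move=> m P mA mB DU; apply: (mulIr DU); rewrite mul0r.
have PD : P * (B - A) = (B - A) * B by rewrite mulrVK.
clearbody P.
have e3 : P ^+ 2 * (B - A) + A * P * (B - A) + A ^+ 2 * (B - A) =
          B ^+ 3 - A ^+ 3.
  rewrite expr2 -!mulrA PD (mulrA P) PD !mulrBl !mulrBr !mulrA subrKA.
  by rewrite !exprS !expr0 !mulr1 !mulrA subrKA.
have e2 : P * (B - A) + A * (B - A) = B ^+ 2 - A ^+ 2.
  by rewrite PD mulrBl mulrBr subrKA.
rewrite !mulrDl e3 -scalerAl mulrDl e2.
have -> : b%:M * (B - A) = b *: (B - A) by exact: mul_scalar_mx.
have := congr2 +%R mB (congr1 -%R mA).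
rewrite !horner_mx_cubic oppr0 addr0 => <-.
by rewrite !opprD !scalerBr !addrA [RHS](ACl (1*5*2*6*3*7*(4*8)))/= subrr addr0.
Qed.

Lemma size_monic_cubic (F : fieldType) (a b c : F) (m : {poly F}) :
  m = 'X^3 + a *: 'X^2 + b *: 'X + c%:P -> size m = 4 /\ m \is monic.
Proof.
have q_size : (size (a *: 'X^2 + b *: 'X + c%:P)%R < size ('X^3 : {poly F}))%N.
  rewrite size_polyXn ltnS (leq_trans (size_polyD _ _)) // geq_max.
  rewrite (leq_trans (size_polyC_leq1 _)) // andbT.
  rewrite (leq_trans (size_polyD _ _)) // geq_max.
  rewrite (leq_trans (size_scale_leq _ _)) ?size_polyXn //=.
  by rewrite (leq_trans (size_scale_leq _ _)) ?size_polyX.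
move=> ->; rewrite -!addrA in q_size *.
by rewrite monicE lead_coefDl // lead_coefXn size_polyDl // size_polyXn.
Qed.

(** Without commutativity, [P^2 - P'^2 = P (P - P') + (P - P') P']. When both quadratics vanish,
    [P - P'] is thus an intertwiner. *)
Lemma quadratic_sub (R : pzRingType) (V : lalgType R) (A P P' t : V) (a : R) :
  (P ^+ 2 + A * P + A ^+ 2 + a *: (P + A) + t) -
  (P' ^+ 2 + A * P' + A ^+ 2 + a *: (P' + A) + t) =
  (P + A + a%:A) * (P - P') + (P - P') * P'.
Proof.
rewrite opprD addrACA subrr addr0 opprD addrACA -scalerBr.
rewrite (opprD P') (addrACA P) subrr addr0.
rewrite (opprD _ (A ^+ 2)) (addrACA _ (A ^+ 2)) subrr addr0.
rewrite opprD (addrACA _ (A * P)) -mulrBr !mulrDl mulr_algl.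
rewrite [RHS]addrAC; congr (_ + _); rewrite [RHS]addrAC; congr (_ + _).
by rewrite mulrBr mulNr subrKA -!expr2.
Qed.

Lemma quadratic_coef_eq0 (F : fieldType) (a b c : F) (m : {poly F})
    (A B C r2 r1 r0 : 'M[F]_3) :
  m = 'X^3 + a *: 'X^2 + b *: 'X + c%:P -> irreducible_poly m ->
  horner_mx A m = 0 -> horner_mx B m = 0 -> horner_mx C m = 0 ->
  B - A \is a GRing.unit -> C - A \is a GRing.unit ->
  (B - A) * B / (B - A) <> (C - A) * C / (C - A) ->
  (forall Y, [\/ Y = A, Y = B | Y = C] -> r2 * Y ^+ 2 + r1 * Y + r0 = 0) ->
  [/\ r2 = 0, r1 = 0 & r0 = 0].
Proof.
move=> m_def m_irr mA mB mC BU CU neq r_root.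
have rA := r_root A (Or31 _ _ erefl).
have [m_size _] := size_monic_cubic m_def.
(* As [Y^2 - A^2 = (Y - A) Y + A (Y - A)], the difference of the values at [Y] and [A] can be
   divided by [Y - A] on the right. *)
have r1E Y : [\/ Y = A, Y = B | Y = C] -> Y - A \is a GRing.unit ->
    r2 * ((Y - A) * Y / (Y - A)) = - (r2 * A + r1).
  move=> /r_root rY DU; apply: (mulIr DU).
  rewrite mulrA mulrVK // mulNr; apply/eqP; rewrite -addr_eq0; apply/eqP.
  transitivity ((r2 * Y ^+ 2 + r1 * Y + r0) - (r2 * A ^+ 2 + r1 * A + r0)).
    rewrite mulrBl -expr2 mulrBr [X in _ + X]mulrBr !mulrDl -!mulrA -expr2.
    by rewrite [in RHS]opprD [RHS]addrACA subrr addr0 !addrA subrK.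
  by rewrite rY rA subrr.
have rB := r1E B (Or32 _ _ erefl) BU.
have rC := r1E C (Or33 _ _ erefl) CU.
rewrite m_def in mA mB mC.
have qB := conj_root_quadratic mA mB BU.
have qC := conj_root_quadratic mA mC CU.
have := horner_mx_conj CU mC; rewrite -m_def => P'0.
set P := (B - A) * B / _ in neq rB qB.
set P' := (C - A) * C / _ in neq rC qC P'0.
clearbody P P'.
have XU : P - P' \is a GRing.unit.
  apply: (@intertwiner_unit _ _ m (- (P + A + a%:A)) P') => //; last first.
    by rewrite subr_eq0; apply/eqP.
  apply/eqP; rewrite mulNr eqr_oppLR -addr_eq0.
  by rewrite -(quadratic_sub A P P' b%:M) qB qC subrr.
have r20 : r2 = 0.
  by apply: (mulIr XU); rewrite mul0r mulrBr rB rC subrr.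
have r10 : r1 = 0.
  by apply: oppr_inj; rewrite oppr0; move: rB; rewrite r20 !mul0r add0r.
by split=> //; move: rA; rewrite r20 r10 !mul0r !add0r.
Qed.

(** * Null ideals and division by a central polynomial *)

Lemma map_scalar_mx_central (R : comNzRingType) (n : nat) (p : {poly R})
    (f : {poly 'M[R]_n.+1}) :
  map_poly scalar_mx p * f = f * map_poly scalar_mx p.
Proof.
apply/polyP => i; rewrite coefM coefMr; apply: eq_bigr => j _.
by rewrite !coef_map /=; exact/esym/scalar_mxC.
Qed.

Lemma is_core_reduced (F : fieldType) (m : {poly F}) (S : set 'M[F]_3) :
  m \is monic -> (forall A, S A -> horner_mx A m = 0) ->
  (forall r, null_ideal S r -> (size r < size m)%N -> r = 0) ->
  is_core S.
Proof.
move=> m_monic Sm Sred; pose M : {poly 'M[F]_3} := map_poly scalar_mx m.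
have scalar_inj : injective (@scalar_mx F 3).
  by move=> x y /matrixP/(_ 0 0); rewrite !mxE !mulr1n.
have hornerM (f : {poly 'M[F]_3}) A : S A -> (f * M).[A] = 0.
  move=> /Sm mA; have M0 : M.[A] = 0 by exact: mA.
  by rewrite hornerM_comm /comm_poly M0 ?mulr0 ?mul0r.
have M_monic : M \is monic.
  by rewrite monicE lead_coef_map_inj ?(monicP m_monic) // raddf0.
have M_size : size M = size m by rewrite size_map_inj_poly // raddf0.
split=> [A _|f g f0 g0 A SA|f g g0 A SA|h f f0 A SA].
- by rewrite horner0.
- by rewrite hornerD hornerN f0 // g0 // subrr.
(* Right evaluation is not multiplicative, but [(f X + k) g] has value [(f g)(A) A + k g(A)], so the
   left factor can be built up by induction. *)
- elim/poly_ind: f A SA => [|f k IH] A SA; first by rewrite mul0r horner0.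
  rewrite mulrDl -mulrA -commr_polyX mulrA hornerD hornerMX hornerCM.
  by rewrite IH // mul0r add0r g0 // mulr0.
(* The remainder of [f] modulo [M] is again in the null ideal, hence zero. In [f h] the central
   factor [M] can then be moved to the far right. *)
have fE := Pdiv.RingMonic.rdivp_eq M_monic f.
set r := Pdiv.Ring.rmodp f M in fE.
have r0 : r = 0.
  apply: Sred => [B SB|]; last by rewrite -M_size Pdiv.Ring.ltn_rmodpN0 ?monic_neq0.
  by have := f0 B SB; rewrite fE hornerD hornerM // add0r.
by rewrite fE r0 addr0 -mulrA map_scalar_mx_central mulrA hornerM.
Qed.

(** * Counting the solutions of the Sylvester equation [Y P - A Y = 1] *)

Lemma sylvester_sub (R : pzRingType) (A P Y1 Y2 : R) :
  Y1 * P - A * Y1 = 1 -> Y2 * P - A * Y2 = 1 ->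
  A * (Y1 - Y2) = (Y1 - Y2) * P.
Proof.
move=> /(canRL (subrK _)) Y1P /(canRL (subrK _)) Y2P.
by rewrite mulrBl mulrBr Y1P Y2P opprD addrACA subrr add0r.
Qed.

(** With [Z = Y1 - Y2], an invertible intertwiner, [Y1 + p(A) Z] is a solution for every polynomial
    [p]. As [w] is cyclic for [A], the rows [w p(A)] exhaust the space. *)
Lemma sylvester_row_surj (F : fieldType) (n : nat) (m : {poly F})
    (A P Y1 Y2 : 'M[F]_n.+1) (w t : 'rV[F]_n.+1) :
  irreducible_poly m -> size m = n.+2 ->
  horner_mx A m = 0 -> horner_mx P m = 0 ->
  Y1 * P - A * Y1 = 1 -> Y2 * P - A * Y2 = 1 -> Y1 != Y2 -> w != 0 ->
  exists2 Y : 'M[F]_n.+1, Y * P - A * Y = 1 & w *m Y = t.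
Proof.
move=> m_irr m_size mA mP Y1s Y2s Y12 w0.
pose Z := Y1 - Y2.
have AZ : A * Z = Z * P := sylvester_sub Y1s Y2s.
have ZU : Z \in unitmx.
  by apply: (intertwiner_unit m_irr _ mP AZ); rewrite ?subr_eq0.
clearbody Z.
have wU := cyclic_mx_unit m_irr m_size mA w0.
pose x := (t - w *m Y1) *m invmx Z *m invmx (cyclic_mx w A).
pose H := horner_mx A (rVpoly x).
have HA : A * H = H * A by exact/esym/(comm_horner_mx _ (erefl (A *m A))).
exists (Y1 + H * Z).
  rewrite mulrDl mulrDr opprD addrACA Y1s !mulrA HA -!mulrA AZ subrr.
  by rewrite addr0.
rewrite mulmxDr mulmxA -mul_cyclic_mx (mulmxKV wU) (mulmxKV ZU).
by rewrite addrC subrK.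
Qed.

(* Every row [w] of the kernel of [Y] satisfies [w = - w A Y], hence lies in the
   row space of [Y]. *)
Lemma sylvester_rank (F : fieldType) (n : nat) (A P Y : 'M[F]_n.+1) :
  Y * P - A * Y = 1 -> (n.+1 <= (\rank Y).*2)%N.
Proof.
move=> YP; have : (kermx Y <= Y)%MS.
  rewrite -[kermx Y]mulr1 -YP mulrBr mulrA [kermx Y * Y]mulmx_ker mul0r sub0r.
  by rewrite mulrA -mulNr submxMl.
move=> /mxrankS; rewrite mxrank_ker -addnn; lia.
Qed.

Lemma card_sylvester_unit (F : finFieldType) (m : {poly F})
    (A P : 'M[F]_3) :
  irreducible_poly m -> size m = 4 ->
  horner_mx A m = 0 -> horner_mx P m = 0 ->
  (#|[set Y : 'M[F]_3 | (Y \is a GRing.unit) && (Y * P - A * Y == 1)%R]|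
     < #|F| ^ 3 - #|F| ^ 2 - #|F|)%N.
Proof.
move=> m_irr m_size mA mP; set q := #|F|.
have q_gt1 : (1 < q)%N by exact: finNzRing_gt1.
pose Sol := [set Y : 'M[F]_3 | Y * P - A * Y == 1].
set U := [set Y | _].
have U_Sol : U = Sol :&: [set Y | Y \is a GRing.unit].
  by apply/setP => Y; rewrite !inE andbC.
(* With at most one solution the bound holds because [q^3 - q^2 - q >= 2] for [q >= 2]. *)
have [Sol1|] := leqP #|Sol| 1.
  have : (#|U| <= 1)%N.
    by apply: leq_trans Sol1; rewrite U_Sol subset_leq_card ?subsetIl.
  by move: q_gt1; clearbody q; move=> ? ?; nia.
move=> /card_gt1P[Y1 [Y2]]; rewrite !inE => -[/eqP Y1s /eqP Y2s Y12].
have surj w t :=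
  @sylvester_row_surj _ _ _ _ _ _ _ w t m_irr m_size mA mP Y1s Y2s Y12.
pose Sing := Sol :\: [set Y | Y \is a GRing.unit].
have cardU : #|Sol| = (#|U| + #|Sing|)%N by rewrite U_Sol cardsID.
(* A solution is determined by its first row: two distinct solutions have an invertible difference,
   whose first row is nonzero. *)
have Sol_le : (#|Sol| <= q ^ 3)%N.
  have -> : (q ^ 3 = #|{: 'rV[F]_3}|)%N by rewrite card_mx mul1n.
  apply: (@leq_card_in _ _ (row 0)) => Y Y'; rewrite !inE => /eqP Ys /eqP Y's e.
  apply/eqP; rewrite -subr_eq0; apply/negPn/negP => Z0.
  have AZ := sylvester_sub Ys Y's.
  have ZU : Y - Y' \in unitmx by exact: (intertwiner_unit m_irr _ mP AZ).
  have : delta_mx 0 0 *m (Y - Y') = 0 :> 'rV_3 by rewrite -rowE raddfB /= e subrr.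
  move=> /(congr1 (mulmx^~ (invmx (Y - Y')))); rewrite mulmxK // mul0mx.
  by move=> /rowP/(_ 0)/eqP; rewrite !mxE oner_eq0.
(* The punctured left kernels of the singular solutions cover all nonzero rows. *)
have Sing_ge : (q ^ 3 - 1 <= #|Sing| * (q - 1))%N.
  pose W (Y : 'M[F]_3) := rowg (kermx Y) :\ 0.
  have -> : (q ^ 3 - 1 = #|[set~ (0%R : 'rV[F]_3)]|)%N by rewrite cardsC1 card_mx mul1n subn1.
  apply: (@leq_trans #|\bigcup_(Y in Sing) W Y|).
    apply: subset_leq_card; apply/fintype.subsetP => w; rewrite !inE => w0.
    have [Y Ys wY] := surj w 0 w0.
    apply/finset.bigcupP; exists Y; rewrite !inE ?w0 ?mem_rowg /=; last exact/sub_kermxP.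
    rewrite Ys eqxx andbT; apply/negP => YU; case/negP: w0.
    by rewrite -[w](mulmxK YU) wY mul0mx.
  have le_big : (#|\bigcup_(Y in Sing) W Y| <= \sum_(Y in Sing) #|W Y|)%N.
    apply: (big_ind2 (fun (X : {set 'rV[F]_3}) k => #|X| <= k)%N) => // [|X k X' k' le le'].
      by rewrite cards0.
    by apply: leq_trans (leq_card_setU _ _).1 _; exact: leq_add.
  apply: leq_trans le_big _; rewrite -sum_nat_const; apply: leq_sum => Y.
  rewrite !inE => /andP[_ /eqP /sylvester_rank Yr].
  have -> : #|W Y| = (q ^ \rank (kermx Y)).-1.
    by rewrite -card_rowg [in RHS](cardsD1 0) mem_rowg sub0mx.
  rewrite -subn1 leq_sub2r // -[leqRHS]expn1 leq_exp2l // mxrank_ker.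
  by lia.
move: Sing_ge Sol_le; rewrite cardU; clearbody q; move: #|U| #|Sing| => u s.
move=> h1 h2.
(* From [q^3 - 1 = (q - 1) (q^2 + q + 1)]; the last 1 makes the bound on the invertible solutions
   strict. *)
have h3 : (q ^ 2 + q + 1 <= s)%N.
  rewrite -(@leq_pmul2r (q - 1)) ?subn_gt0 //; apply: leq_trans h1; nia.
lia.
Qed.

(** At most one index gives [A]. If all the others shared one conjugate [P], the inverses of
    [g i - A] would be too many invertible solutions of [Y P - A Y = 1]. *)
Lemma exists_distinct_conj (F : finFieldType) (m : {poly F}) (I : finType)
    (A : 'M[F]_3) (g : I -> 'M[F]_3) :
  irreducible_poly m -> size m = 4 -> horner_mx A m = 0 ->
  (forall i, horner_mx (g i) m = 0) -> injective g ->
  (forall i, g i != A -> g i - A \is a GRing.unit) ->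
  (#|F| ^ 3 - #|F| ^ 2 - #|F| < #|I|)%N ->
  exists i j, [/\ g i - A \is a GRing.unit, g j - A \is a GRing.unit
    & (g i - A) * g i / (g i - A) <> (g j - A) * g j / (g j - A)].
Proof.
move=> m_irr m_size mA mg g_inj gU I_gt.
pose conj i := (g i - A) * g i / (g i - A).
have eqA_le1 : (#|[set i | g i == A]| <= 1)%N.
  apply/card_le1_eqP => i j; rewrite !inE => /eqP giA /eqP gjA.
  by apply: g_inj; rewrite giA.
have neqA_ge : (#|F| ^ 3 - #|F| ^ 2 - #|F| <= #|[set i | g i != A]|)%N.
  have -> : [set i | g i != A] = ~: [set i | g i == A].
    by apply/setP => i; rewrite !inE.
  by move: (cardsC [set i | g i == A]) eqA_le1 I_gt; lia.
have F_gt1 : (1 < #|F|)%N by exact: finNzRing_gt1.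
have /card_gt0P[i0] : (0 < #|[set i | g i != A]|)%N.
  apply: leq_trans neqA_ge; move: F_gt1; move: #|F| => q; nia.
rewrite inE => gi0.
have [/existsP[i /andP[gi neq]]|] :=
    boolP [exists i, (g i != A) && (conj i != conj i0)].
  by exists i, i0; split; [exact: gU | exact: gU | exact/eqP].
move=> /existsPn conj_eq.
have mP : horner_mx (conj i0) m = 0 by apply: horner_mx_conj; [exact: gU|].
have := card_sylvester_unit m_irr m_size mA mP.
rewrite ltnNge => /negP[]; apply: leq_trans neqA_ge _.
rewrite -(card_in_imset (f := fun i => (g i - A)^-1)); last first.
  by move=> i j _ _ /invr_inj/addIr/g_inj.
apply/subset_leq_card/fintype.subsetP => _ /imsetP[i /[!inE] giA ->].
rewrite unitrV gU //=.
have /eqP <- : conj i == conj i0.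
  by have := conj_eq i; rewrite giA negbK.
(* With [D = g i - A]: [D^-1 (D (g i) D^-1) - A D^-1 = (g i - A) D^-1 = 1]. *)
by rewrite /conj -mulrA mulKr ?gU // -mulrBl mulrV ?gU.
Qed.

(** * From cardinalities of sets to finite fields, and the two criteria *)

Local Open Scope classical_set_scope.
Local Open Scope card_scope.

(** The counting needs a [finFieldType]. An equality of field structures, rather than an
    isomorphism, lets [F] be replaced outright by [K]. *)
Lemma finField_of_card (F : fieldType) (q : nat) :
  [set: F] #= `I_q ->
  exists K : finFieldType, (K : fieldType) = F /\ #|K| = q.
Proof.
(* Records have no eta: [F] has to be destructed for the field packed below to
   be convertible to it. *)
case: F => T cT; destruct cT; set F := GRing.Field.Pack _.
move=> /card_set_bijP[f [f_fun f_inj f_surj]].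
have lt_f x : (f x < q)%N by exact: f_fun.
pose h x := Ordinal (lt_f x).
have h_inj : injective h by move=> x y [] /f_inj; apply; rewrite inE.
have h_surj i : exists x, h x == i.
  by have [x _ fx] := f_surj i (ltn_ord i); exists x; apply/eqP/val_inj.
pose g i := xchoose (h_surj i).
have gK : cancel g h by move=> i; apply/eqP/(xchooseP (h_surj i)).
have hK : cancel h g by move=> x; apply: h_inj; rewrite gK.
pose C : countType := HB.pack (F : Type) (Choice.class F) (CanIsCountable hK).
pose K : finFieldType := HB.pack F (CanIsCountable hK) (@CanIsFinite C _ h g hK).
exists K; split; first reflexivity.
by rewrite -[RHS]card_ord; apply: (@bij_eq_card K 'I_q h); exists g.
Qed.

Lemma is_core_conj (F : fieldType) (a b c : F) (m : {poly F})
    (S : set 'M[F]_3) (A B C : 'M[F]_3) :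
  m = 'X^3 + a *: 'X^2 + b *: 'X + c%:P -> irreducible_poly m ->
  S `<=` minpoly_class m -> S A -> S B -> S C ->
  B - A \is a GRing.unit -> C - A \is a GRing.unit ->
  (B - A) * B / (B - A) <> (C - A) * C / (C - A) ->
  is_core S.
Proof.
move=> m_def m_irr S_sub SA SB SC BU CU neq.
have [m_size m_monic] := size_monic_cubic m_def.
have Sm Y : S Y -> horner_mx Y m = 0 by move=> /S_sub <-; exact: mx_root_minpoly.
apply: (is_core_reduced m_monic Sm) => r r0; rewrite m_size ltnS => r_size.
have rE Y : r.[Y] = r`_2 * Y ^+ 2 + r`_1 * Y + r`_0.
  rewrite (horner_coef_wide Y r_size) !big_ord_recr big_ord0 /= add0r.
  by rewrite expr0 mulr1 expr1 [RHS]addrC [X in _ = _ + X]addrC addrA.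
have [|r20 r10 r00] := quadratic_coef_eq0 m_def m_irr (Sm _ SA) (Sm _ SB)
    (Sm _ SC) BU CU neq (r2 := r`_2) (r1 := r`_1) (r0 := r`_0).
  by move=> Y [] ->; rewrite -rE r0.
apply/polyP => -[|[|[|i]]]; rewrite coef0 //.
by rewrite nth_default // (leq_trans r_size).
Qed.

Theorem corollary5p13 (F : fieldType) (a b c : F) (m : {poly F})
    (m_def : m = 'X^3 + a *: 'X^2 + b *: 'X + c%:P)
    (m_irr : irreducible_poly m)
    (S : set 'M[F]_3) (S_sub : S `<=` minpoly_class m) :
  (separable_poly m ->
   (exists A B C : 'M[F]_3,
      [/\ S A, S B & S C] /\
      [/\ B - A \is a GRing.unit, C - A \is a GRing.unit
        & (B - A) * B * (B - A)^-1 <> (C - A) * C * (C - A)^-1]) ->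
   is_core S)
  /\
  (forall q : nat,
   [set: F] #= `I_q ->
   `I_(q ^ 3 - q ^ 2 - q + 1)%N #<= S ->
   (exists2 A, S A & S `<=` unit_diff m A `|` [set A]) ->
   is_core S).
Proof.
split=> [_ [A [B [C [[SA SB SC] [BU CU neq]]]]]|q].
  exact: (is_core_conj m_def m_irr S_sub SA SB SC).
move=> /finField_of_card[K [KF Kq]] /card_leP[f] [A SA S_unit].
destruct KF; rewrite -Kq in f.
have [m_size _] := size_monic_cubic m_def.
have Sm Y : S Y -> horner_mx Y m = 0 by move=> /S_sub <-; exact: mx_root_minpoly.
pose N := (#|K| ^ 3 - #|K| ^ 2 - #|K| + 1)%N.
(* The injection witnessing the cardinality bound is read as a finite family in [S], which may
   itself be larger. *)
pose g (i : 'I_N) : 'M[K]_3 := val (f (exist _ (val i) (mem_set (ltn_ord i)))).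
have Sg i : S (g i) by apply: set_mem; exact: valP.
have g_inj : injective g.
  move=> i j /val_inj /(inj (f := f)) fij; apply/val_inj.
  by have /(congr1 val) := fij (in_setT _) (in_setT _).
have gU i : g i != A -> g i - A \is a GRing.unit.
  by case: (S_unit _ (Sg i)) => [[] //|->]; rewrite eqxx.
have [|i [j [iU jU neq]]] := exists_distinct_conj m_irr m_size (Sm _ SA)
    (fun i => Sm _ (Sg i)) g_inj gU.
  by rewrite card_ord /N addn1.
exact: (is_core_conj m_def m_irr S_sub SA (Sg i) (Sg j)).
Qed.
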